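(* Assume (H1)--(H3) and (D1)--(D2) of the context. Then for every compact set $K\subset\mathbb R^p$, $$\mathbb D\Big(\mathrm{Graph}_K\,\mathbb E_{z\sim\pi_{\beta,(\cdot)}}[\nabla_wh(\cdot,z)],\ \mathrm{Graph}_K\,\partial^cH\Big)\longrightarrow0\qquad\text{as }\beta\to0^+.$$
   Context: $\mathcal Z$ is a Polish space, $\pi_0$ a Borel probability measure on $\mathcal Z$, $h:\mathbb R^p\times\mathcal Z\to\mathbb R$. (H1) $\mathrm{supp}(\pi_0)=\mathcal Z$. (H2) $h$ is continuous on $\mathbb R^p\times\mathcal Z$. (H3) There exist $\eta>0$, a continuous coercive $\psi:\mathcal Z\to[0,\infty)$ (all sublevel sets compact) and a locally bounded $\kappa:\mathbb R^p\to[1,\infty)$ with $\int\psi^{1+\eta}d\pi_0<\infty$ and $h(w,z)\le-\kappa(w)\psi(z)$ for all $(w,z)$. (D1) For all $z$, $h(\cdot,z)$ is differentiable and its gradient $\nabla_wh$ in the first variable is jointly continuous. (D2) There exist $\eta>0$, a continuous $\Psi:\mathcal Z\to[0,\infty)$ and a locally bounded $C:\mathbb R^p\to[1,\infty)$ with $\int\Psi^{1+\eta}d\pi_0<\infty$ and $\|\nabla_wh(w,z)\|\le C(w)\Psi(z)$ for all $(w,z)$. $H(w)=\max_{z\in\mathcal Z}h(w,z)$. For $\beta>0$, $\pi_{\beta,w}$ is the Gibbs measure $d\pi_{\beta,w}(z)=e^{h(w,z)/\beta}d\pi_0(z)/\int e^{h(w,u)/\beta}d\pi_0(u)$. The Clarke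 subdifferential $\partial^cH(w)$ is the convex hull of all limits $\lim_k\nabla H(w_k)$ with $w_k\to w$ and $H$ differentiable at $w_k$. For a (single- or set-valued) map $D$, $\mathrm{Graph}_KD=\{(w,v):w\in K,\ v\in D(w)\}$. The excess distance is $\mathbb D(A,B)=\sup_{a\in A}\inf_{b\in B}\|a-b\|$ (Euclidean norm). *)

(* Defs.v *)
From HB Require Import structures.
From mathcomp Require Import all_boot all_order all_algebra.
From mathcomp Require Import all_classical all_reals all_analysis.

Set Implicit Arguments.
Unset Strict Implicit.
Unset Printing Implicit Defensive.

Import Order.TTheory GRing.Theory Num.Theory.
Import numFieldNormedType.Exports.

Local Open Scope classical_set_scope.
Local Open Scope ring_scope.

Definition separable (T : topologicalType) : Prop :=
  exists2 D : set T, countable D & dense D.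

Notation borel T := (g_sigma_algebraType (@open T)).

Definition measure_support (R : realType) (T : ptopologicalType)
    (mu : {measure set (borel T) -> \bar R}) : set T :=
  [set z | forall U : set T, open_nbhs z U -> (0 < mu U)%E].

Definition locally_bounded (R : realType) (T : topologicalType)
    (f : T -> R) : Prop :=
  forall x : T, bounded_near f (nbhs x).

Definition coercive (R : realType) (T : topologicalType) (f : T -> R) : Prop :=
  forall c : R, compact [set z | f z <= c].

(* The greatest element of A; the default value 0 is only returned when A has
   no greatest element. *)
Definition maximum (R : realType) (A : set R) : R :=
  xget 0 (A `&` ubound A).

(* The norm of the library on 'rV[R]_n is the sup norm; it induces the same
   topology and the same notion of differentiability. *)
Definition euclidean_norm (R : realType) (n : nat) (v : 'rV[R]_n) : R :=
  Num.sqrt (\sum_(i < n) v 0 i ^+ 2).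

Definition gradient (R : realType) (n : nat) (f : 'rV[R]_n -> R)
    (w : 'rV[R]_n) : 'rV[R]_n :=
  \row_(i < n) 'D_(delta_mx 0 i) f w.

Definition convex_hull (R : realType) (n : nat) (A : set 'rV[R]_n) :
    set 'rV[R]_n :=
  [set v | exists (m : nat) (l : 'I_m -> R) (x : 'I_m -> 'rV[R]_n),
    [/\ forall i, 0 <= l i, \sum_(i < m) l i = 1, forall i, A (x i)
      & v = \sum_(i < m) l i *: x i]].

Definition clarke_subdifferential (R : realType) (n : nat)
    (f : 'rV[R]_n -> R) (w : 'rV[R]_n) : set 'rV[R]_n :=
  convex_hull [set v | exists u : nat -> 'rV[R]_n,
    [/\ forall k, differentiable f (u k),
        u k @[k --> \oo] --> w
      & gradient f (u k) @[k --> \oo] --> v]].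

(* Pairs (w, v) are represented by the concatenation of w and v, so that the
   Euclidean norm of 'rV[R]_(n + m) is the Euclidean norm on the product. *)
Definition graph_on (R : realType) (n m : nat) (K : set 'rV[R]_n)
    (D : 'rV[R]_n -> set 'rV[R]_m) : set 'rV[R]_(n + m) :=
  [set x | exists w v, [/\ K w, D w v & x = row_mx w v]].

(* The supremum is taken in [0, +oo]: adding 0 only matters when A is empty,
   where the bare ereal_sup would be -oo. *)
Definition excess (R : realType) (n : nat) (A B : set 'rV[R]_n) : \bar R :=
  ereal_sup (0%E |`
    [set ereal_inf [set (euclidean_norm (a - b))%:E | b in B] | a in A]).

Section gibbs.
Context (R : realType) (d : measure_display) (T : measurableType d).
Context (pi0 : {measure set T -> \bar R}) (p : nat) (h : 'rV[R]_p -> T -> R).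

Definition gibbs_density (beta : R) (w : 'rV[R]_p) (z : T) : R :=
  expR (h w z / beta) / \int[pi0]_u expR (h w u / beta).

Definition gibbs (beta : R) (w : 'rV[R]_p) (A : set T) : \bar R :=
  (\int[pi0]_(z in A) (gibbs_density beta w z)%:E)%E.

Definition gibbs_mean_gradient (beta : R) (w : 'rV[R]_p) : 'rV[R]_p :=
  \row_(i < p)
    fine (\int[gibbs beta w]_z (gradient (h ^~ z) w 0 i)%:E)%E.

End gibbs.

(* Main.v *)
From HB Require Import structures.
Require Import Defs.
From mathcomp Require Import all_boot all_order all_algebra.
From mathcomp Require Import all_classical all_reals all_analysis.
From mathcomp Require Import measurable_realfun ring lra.
Import Order.TTheory GRing.Theory Num.Theory.
Import numFieldNormedType.Exports.
Local Open Scope classical_set_scope.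
Local Open Scope ring_scope.

(* The argument localizes: near a point w and for small beta, the mean gradient
   G is close to the convex hull of the limiting gradients of H at w. Since a
   point is close to a convex hull as soon as no direction d separates it, it
   suffices to compare, for every d, the number <G, d> with the limiting
   gradients, and this is done through M(w) = argmax h(w, .).

   Upper bound for G: coercivity and continuity force every z with h(w', z) close
   to H(w), w' near w, to have its gradient close to some nabla h(w, z') with
   z' in M(w). The complement carries Gibbs mass O(exp(- delta / beta)), because
   pi0 charges the neighbourhoods of the points of M(w), and Psi is integrable.

   Lower bound for H: maximizing h(x, z) - n |x - a|^2 jointly in (x, z) yields a
   point x close to a where H is touched from above by a paraboloid and from
   below by h(., z), hence differentiable with gradient nabla h(x, z). Taking
   such points x very close to w + t d and using, for z0 in M(w) and z in M(x),
     h(x, z) - h(w, z) >= H(x) - H(w) >= h(x, z0) - h(w, z0)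
   and the mean value theorem on both sides gives <nabla H(x), d> >=
   <nabla h(w, z0), d> - o(1) as t -> 0. No appeal to Rademacher's theorem is
   needed. *)

Set Implicit Arguments.
Unset Strict Implicit.
Unset Printing Implicit Defensive.

(** * Euclidean inner product and its comparison with the sup norm *)

Section dot_product.
Context {R : realType} {n : nat}.
Implicit Types (u v w : 'rV[R]_n) (a : R).

Definition dot u v : R := \sum_(i < n) u 0 i * v 0 i.

Lemma dotC u v : dot u v = dot v u.
Proof. by apply: eq_bigr => i _; rewrite mulrC. Qed.

Lemma dotDr u v w : dot u (v + w) = dot u v + dot u w.
Proof. by rewrite -big_split; apply: eq_bigr => i _; rewrite !mxE mulrDr. Qed.

Lemma dotZr a u v : dot u (a *: v) = a * dot u v.
Proof. by rewrite /dot big_distrr; apply: eq_bigr => i _; rewrite !mxE mulrCA. Qed.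

Lemma dotNr u v : dot u (- v) = - dot u v.
Proof. by rewrite -scaleN1r dotZr mulN1r. Qed.

Lemma dotBr u v w : dot u (v - w) = dot u v - dot u w.
Proof. by rewrite dotDr dotNr. Qed.

Lemma dotDl u v w : dot (u + v) w = dot u w + dot v w.
Proof. by rewrite !(dotC _ w) dotDr. Qed.

Lemma dotZl a u v : dot (a *: u) v = a * dot u v.
Proof. by rewrite !(dotC _ v) dotZr. Qed.

Lemma dotBl u v w : dot (u - v) w = dot u w - dot v w.
Proof. by rewrite !(dotC _ w) dotBr. Qed.

Lemma dot0r u : dot u 0 = 0.
Proof. by rewrite -(scale0r 0) dotZr mul0r. Qed.

Lemma dot_ge0 u : 0 <= dot u u.
Proof. by apply: sumr_ge0 => i _; rewrite -expr2 sqr_ge0. Qed.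

Lemma dot_add u v : dot (u + v) (u + v) = dot u u + 2 * dot u v + dot v v.
Proof. by rewrite dotDl !dotDr (dotC v u); ring. Qed.

Lemma dot_sub_le u v : dot (u - v) (u - v) <= 2 * dot u u + 2 * dot v v.
Proof.
have := dot_ge0 (u + v).
by rewrite dotBl !dotBr dotDl !dotDr (dotC v u); lra.
Qed.

Lemma dot_subZ u v a : dot (u - a *: v) (u - a *: v) =
  dot u u - 2 * a * dot v u + a ^+ 2 * dot v v.
Proof.
by rewrite dotBl (dotBr u) (dotBr (a *: v)) !dotZl !dotZr (dotC u v); ring.
Qed.

Lemma euclidean_norm_ge0 u : 0 <= euclidean_norm u.
Proof. exact: sqrtr_ge0. Qed.

Lemma sqr_euclidean_norm u : euclidean_norm u ^+ 2 = dot u u.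
Proof.
rewrite /euclidean_norm sqr_sqrtr; last by apply: sumr_ge0 => i _; exact: sqr_ge0.
by apply: eq_bigr => i _; rewrite expr2.
Qed.

Lemma euclidean_norm0 : euclidean_norm (0 : 'rV[R]_n) = 0.
Proof. by apply/eqP; rewrite -sqrf_eq0 sqr_euclidean_norm dot0r. Qed.

Lemma euclidean_normN u : euclidean_norm (- u) = euclidean_norm u.
Proof.
by apply/eqP; rewrite -(eqrXn2 (n := 2))// ?euclidean_norm_ge0//
  !sqr_euclidean_norm dotNr dotC dotNr opprK.
Qed.

(** Cauchy-Schwarz, read off the nonnegativity of [dot] on [x *: u - y *: v] for well-chosen [x] and
    [y]. *)
Lemma dot_le u v : dot u v <= euclidean_norm u * euclidean_norm v.
Proof.
set a := euclidean_norm u; set b := euclidean_norm v.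
have a0 : 0 <= a := euclidean_norm_ge0 _; have b0 : 0 <= b := euclidean_norm_ge0 _.
have sqa : a ^+ 2 = dot u u := sqr_euclidean_norm _.
have sqb : b ^+ 2 = dot v v := sqr_euclidean_norm _.
have uv0 x y : 0 <= x ^+ 2 * a ^+ 2 - 2 * x * y * dot u v + y ^+ 2 * b ^+ 2.
  have := dot_ge0 (x *: u - y *: v).
  rewrite !(dotBl, dotBr, dotZl, dotZr) (dotC v u) sqa sqb; lra.
have [ab0|] := ltrP 0 (a * b).
  have : 0 <= (a * b) * (a * b - dot u v) by have := uv0 b a; lra.
  by rewrite pmulr_rge0// subr_ge0.
move=> ab0; have {}ab0 : a * b = 0 by apply/eqP; rewrite eq_le ab0 mulr_ge0.
rewrite ab0 leNgt; apply/negP => t0.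
have tV : (dot u v)^-1 * dot u v = 1 by rewrite mulVf ?gt_eqF.
(* One norm vanishes, so one square drops out of [uv0]; scaling by the inverse of [dot u v] makes
   the cross term outweigh the other square. *)
move/eqP: ab0; rewrite mulf_eq0 => /orP[] /eqP z0.
  have := uv0 ((b ^+ 2 + 1) * (dot u v)^-1) 1; rewrite z0.
  have -> : 2 * ((b ^+ 2 + 1) * (dot u v)^-1) * 1 * dot u v =
    2 * (b ^+ 2 + 1) * ((dot u v)^-1 * dot u v) by ring.
  by rewrite tV; have := sqr_ge0 b; lra.
have := uv0 1 ((a ^+ 2 + 1) * (dot u v)^-1); rewrite z0.
have -> : 2 * 1 * ((a ^+ 2 + 1) * (dot u v)^-1) * dot u v =
  2 * (a ^+ 2 + 1) * ((dot u v)^-1 * dot u v) by ring.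
by rewrite tV; have := sqr_ge0 a; lra.
Qed.

Lemma dot_norm_le u v : `|dot u v| <= euclidean_norm u * euclidean_norm v.
Proof.
rewrite ler_norml dot_le andbT lerNl -dotNr.
by rewrite (le_trans (dot_le _ _))// euclidean_normN.
Qed.

Lemma ler_euclidean_normD u v :
  euclidean_norm (u + v) <= euclidean_norm u + euclidean_norm v.
Proof.
rewrite -(@ler_pXn2r _ 2)// ?nnegrE ?addr_ge0 ?euclidean_norm_ge0//.
rewrite sqr_euclidean_norm dotDl !dotDr (dotC v u) sqrrD !sqr_euclidean_norm.
have := dot_le u v; lra.
Qed.

Lemma coord_le_norm u i : `|u 0 i| <= `|u|.
Proof. by rewrite [leRHS]/Num.norm/= mx_normrE (le_bigmax _ _ (0, i)). Qed.

Lemma euclidean_normZ a u : euclidean_norm (a *: u) = `|a| * euclidean_norm u.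
Proof.
apply/eqP; rewrite -(eqrXn2 (n := 2))// ?mulr_ge0 ?euclidean_norm_ge0//.
by rewrite exprMn !sqr_euclidean_norm dotZl dotZr real_normK ?num_real// mulrA.
Qed.

Lemma euclidean_norm_le u : euclidean_norm u <= n%:R * `|u|.
Proof.
rewrite -(@ler_pXn2r _ 2)// ?nnegrE ?mulr_ge0 ?euclidean_norm_ge0//.
rewrite sqr_euclidean_norm.
have ui i : u 0 i * u 0 i <= `|u| ^+ 2.
  rewrite -expr2 -real_normK ?num_real// ler_pXn2r// ?nnegrE//.
  exact: coord_le_norm.
have : dot u u <= \sum_(i < n) `|u| ^+ 2 by apply: ler_sum => i _.
rewrite sumr_const card_ord => /le_trans; apply.
rewrite -(mulr_natl (`|u| ^+ 2)) exprMn ler_wpM2r ?sqr_ge0// -natrX ler_nat.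
by case: n => // k; rewrite expnS expn1 leq_pmulr.
Qed.

Lemma coord_le_euclidean_norm u i : `|u 0 i| <= euclidean_norm u.
Proof.
rewrite -(@ler_pXn2r _ 2)// ?nnegrE ?euclidean_norm_ge0//.
rewrite sqr_euclidean_norm real_normK ?num_real// /dot (bigD1 i)//= -expr2 lerDl.
by apply: sumr_ge0 => j _; rewrite -expr2 sqr_ge0.
Qed.

Lemma norm_le_euclidean_norm u : `|u| <= euclidean_norm u.
Proof.
rewrite [leLHS]/Num.norm/= mx_normrE; apply: bigmax_le => [|[i j] _].
  exact: euclidean_norm_ge0.
by rewrite ord1 coord_le_euclidean_norm.
Qed.

Lemma dot_delta_mx u i : dot u (delta_mx 0 i) = u 0 i.
Proof.
rewrite /dot (bigD1 i)//= big1 ?addr0 ?mxE ?eqxx ?mulr1// => j ji.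
by rewrite mxE eqxx (negbTE ji) mulr0.
Qed.

End dot_product.

(** * Convex hulls and approximate separation *)

Section convex_hull_theory.
Context {R : realType} {n : nat}.
Implicit Types (S : set 'rV[R]_n) (c l v : 'rV[R]_n).

Lemma subset_convex_hull S : S `<=` convex_hull S.
Proof.
move=> l Sl; exists 1%N, (fun=> 1), (fun=> l); split => //.
  by rewrite big_ord1.
by rewrite big_ord1 scale1r.
Qed.

Lemma convex_hull_subset S S' : S `<=` S' -> convex_hull S `<=` convex_hull S'.
Proof.
by move=> SS' _ [m [l [x [l0 l1 Sx ->]]]]; exists m, l, x; split => // i; exact: SS'.
Qed.

Lemma convex_hull_join S c l t : convex_hull S c -> S l -> 0 <= t <= 1 ->
  convex_hull S (c + t *: (l - c)).
Proof.
move=> [m [a [x [a0 a1 Sx cE]]]] Sl /andP[t0 t1].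
(* The new point takes index [ord0] with weight [t]; the old weights shrink by the factor
   [1 - t]. *)
exists m.+1, (fun i => if unlift ord0 i is Some j then (1 - t) * a j else t),
  (fun i => if unlift ord0 i is Some j then x j else l); split.
- by move=> i; case: unliftP => // j _; rewrite mulr_ge0// subr_ge0.
- rewrite big_ord_recl unlift_none.
  under eq_bigr do rewrite liftK.
  by rewrite -big_distrr/= a1 mulr1 addrC subrK.
- by move=> i; case: unliftP.
- rewrite big_ord_recl unlift_none.
  under eq_bigr do rewrite liftK -scalerA.
  rewrite -scaler_sumr -cE scalerBl scale1r scalerBr addrC.
  by rewrite -!addrA; congr (_ + _); rewrite addrC.
Qed.

(* Closedness of the hull is not needed: a nearly nearest point c nearly
   satisfies the variational inequality of the projection, so v - c is a
   direction in which v exceeds every point of S by about |v - c|. *)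
Lemma near_convex_hull S B v e eta : 0 <= e -> 0 < eta ->
    (forall l, S l -> euclidean_norm l <= B) ->
    (forall d s, (forall l, S l -> dot l d <= s) ->
      dot v d <= s + e * euclidean_norm d) ->
  exists2 c, convex_hull S c & euclidean_norm (v - c) <= e + eta.
Proof.
move=> e0 eta0 SB Sv.
(* Over an empty [S] every [s] is admissible, and [d = 0], [s = -1] give a contradiction. *)
have [l0 Sl0] : S !=set0.
  apply/set0P/negP => /eqP S0.
  have : dot v 0 <= -1 + e * euclidean_norm (0 : 'rV[R]_n).
    by apply: Sv => l; rewrite S0.
  by rewrite dot0r euclidean_norm0; lra.
pose E := [set euclidean_norm (v - c) ^+ 2 | c in convex_hull S].
have hiE : has_inf E.
  split.
    exists (euclidean_norm (v - l0) ^+ 2), l0 => //.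
    exact: subset_convex_hull.
  by exists 0 => _ [c _ <-]; exact: sqr_ge0.
have infE c : convex_hull S c -> inf E <= euclidean_norm (v - c) ^+ 2.
  by move=> Sc; apply: ge_inf; [exact: hiE.2|exists c].
pose r := euclidean_norm v + B.
have Sr l : S l -> euclidean_norm (v - l) <= r.
  move=> Sl; rewrite (le_trans (ler_euclidean_normD _ _))// euclidean_normN.
  by rewrite lerD2l SB.
have r0 : 0 <= r by rewrite (le_trans _ (Sr _ Sl0))// euclidean_norm_ge0.
(* [D] will bound the squared distance from [c] to any point of [S]: write [l - c] as
   [(v - c) - (v - l)], where [c] is almost as close to [v] as [l0] is. *)
pose D := 2 * r ^+ 2 + 2 * (r ^+ 2 + 1).
have D0 : 0 < D by rewrite /D; have := sqr_ge0 r; lra.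
pose t := Num.min 1 (eta ^+ 2 / (D + 1)).
have t0 : 0 < t by rewrite lt_min ltr01 divr_gt0 ?exprn_gt0//; lra.
have t1 : t <= 1 by rewrite ge_min lexx.
have tD : t * (D + 1) <= eta ^+ 2.
  by rewrite -ler_pdivlMr ?ge_min ?lexx ?orbT//; lra.
(* The infimum is reached up to [t ^+ 2]: comparing [c] with its moves by [t] towards [S], then
   dividing by [t], leaves an error of order [t] only. *)
have [_ [c Sc <-] cE] := inf_adherent (exprn_gt0 2 t0) hiE.
exists c => //; set d := v - c.
have dd : euclidean_norm d ^+ 2 = dot d d by rewrite sqr_euclidean_norm.
have dl l : S l -> dot l d <= dot c d + t * (D + 1) / 2.
  move=> Sl; have tt : 0 <= t <= 1 by rewrite ltW.
  have := infE _ (convex_hull_join Sc Sl tt).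
  rewrite opprD addrA -/d sqr_euclidean_norm.
  have lcD : dot (l - c) (l - c) <= D.
    have lcE : l - c = d - (v - l) by rewrite /d opprB [RHS]addrC addrA subrK.
    have dr : dot d d <= r ^+ 2 + 1.
      have := infE _ (subset_convex_hull Sl0); have := Sr _ Sl0.
      have := euclidean_norm_ge0 (v - l0).
      rewrite -dd; move: cE; rewrite -/d; have : t ^+ 2 <= 1 by rewrite expr_le1// ltW.
      by nra.
    have vr : dot (v - l) (v - l) <= r ^+ 2.
      by rewrite -sqr_euclidean_norm lerXn2r ?nnegrE ?euclidean_norm_ge0//; exact: Sr.
    by rewrite lcE (le_trans (dot_sub_le _ _))// /D; lra.
  rewrite dot_subZ.
  rewrite -dd (dotBl l c d) => dlt.
  have : t * (2 * (dot l d - dot c d)) <= t * (t * (D + 1)).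
    move: dlt cE lcD; rewrite -/d; set x := dot (l - c) _.
    have := sqr_ge0 t; nra.
  by rewrite ler_pM2l//; lra.
(* In the direction [d = v - c] the hypothesis yields [|d|^2 <= e |d| + eta^2], which fails beyond
   [e + eta]. *)
have := Sv _ _ dl.
have -> : dot v d = dot c d + euclidean_norm d ^+ 2 by rewrite dd -dotDl addrC subrK.
move: tD (euclidean_norm_ge0 d); set x := euclidean_norm d => tD x0 H.
have {}H : x ^+ 2 <= e * x + eta ^+ 2 by have := sqr_ge0 eta; lra.
by rewrite leNgt; apply/negP => xe; nra.
Qed.

End convex_hull_theory.

(** * Gradients and first-order expansions *)

Section gradient_theory.
Context {R : realType} {n : nat}.
Implicit Types (f : 'rV[R]_n -> R) (x g v : 'rV[R]_n).

Lemma diff_gradient f x v : differentiable f x ->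
  'd f x v = dot (gradient f x) v.
Proof.
move=> fx; rewrite {1}(row_sum_delta v) linear_sum/=; apply: eq_bigr => i _.
by rewrite linearZ/= mxE deriveE// mulrC.
Qed.

Lemma near_gradient f x (e : R) : differentiable f x -> 0 < e ->
  \forall y \near x, `|f y - f x - dot (gradient f x) (y - x)| <= e * `|y - x|.
Proof.
move=> fx e0; have /eqaddoP/(_ _ e0) := diff_locally fx.
rewrite (near_shift 0 x) => H; near=> y.
have : `|(f \o shift x - (cst (f x) + 'd f x)) y| <= e * `|y| by near: y.
by rewrite /= !fctE/= -diff_gradient// subr0 addrK opprD addrA.
Unshelve. all: by end_near. Qed.

(** An upper bound alone is enough because it can be tested along [g] itself, where [dot g (t *: g)]
    is at least [t |g|^2]. *)
Lemma near_dot_eq0 x g :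
  (forall e, 0 < e -> \forall y \near x, dot g (y - x) <= e * `|y - x|) -> g = 0.
Proof.
move=> gx; apply/eqP; rewrite -normr_le0 leNgt; apply/negP => g0.
have /gx/nbhs_ballP[r /= r0] : 0 < `|g| / 2 by rewrite divr_gt0.
(* With this [t] the test point [x + t *: g] lies at distance [r / 2] from [x]. *)
pose t := r / (2 * `|g|); have t0 : 0 < t by rewrite divr_gt0// mulr_gt0.
have tg : t * `|g| = r / 2 by rewrite /t invfM; field; rewrite gt_eqF.
move=> /(_ (x + t *: g)); rewrite -ball_normE/= opprD addrA subrr sub0r normrN.
rewrite [x + _]addrC addrK dotZr normrZ gtr0_norm// tg => H.
have : `|g| ^+ 2 <= dot g g.
  rewrite -sqr_euclidean_norm lerXn2r ?nnegrE ?euclidean_norm_ge0//.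
  exact: norm_le_euclidean_norm.
have /H : r / 2 < r by lra.
move=> H1 H2; have : t * `|g| ^+ 2 <= t * (`|g| / 2 * `|g|).
  rewrite (le_trans (ler_wpM2l (ltW t0) H2))// (le_trans H1)// -tg.
  by rewrite mulrCA.
by rewrite ler_pM2l//; nra.
Qed.

(** Converse of [near_gradient]: [dot g] is a continuous linear form, hence the differential by
    uniqueness, and its values on the basis vectors are the entries of [g]. *)
Lemma gradient_unique f x g :
  (forall e, 0 < e -> \forall y \near x,
    `|f y - f x - dot g (y - x)| <= e * `|y - x|) ->
  differentiable f x /\ gradient f x = g.
Proof.
move=> fg.
have lin_g : linear (dot g : 'rV[R]_n -> R) by move=> a u v; rewrite dotDr dotZr.
pose L : {linear 'rV[R]_n -> R} := HB.pack (dot g : 'rV[R]_n -> R)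
  (GRing.isLinear.Build _ _ _ _ (dot g : 'rV[R]_n -> R) lin_g).
have cL : continuous L.
  apply/linear_bounded_continuous; exists (euclidean_norm g * n%:R); split=> [|M gM].
    exact: num_real.
  apply: filterS (nbhs0_le ltr01) => y y1; apply: (le_trans (dot_norm_le g y)).
  rewrite (le_trans _ (ltW gM))// ler_wpM2l ?euclidean_norm_ge0//.
  by rewrite (le_trans (euclidean_norm_le _))// ler_piMr.
have fL e : 0 < e ->
    \forall y \near (0 : 'rV[R]_n), `|f (y + x) - (f x + L y)| <= e * `|y|.
  move=> e0; have := fg e e0; rewrite (near_shift 0 x).
  by apply: filterS => y; rewrite /= subr0 addrK opprD addrA.
have dL : 'd f x = L :> ('rV[R]_n -> R).
  by apply: diff_unique => //; apply/eqaddoP => e; exact: fL.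
have df : differentiable f x.
  by apply/diff_locallyP; rewrite dL; split => //; apply/eqaddoP => e; exact: fL.
split=> //; apply/rowP => i.
by rewrite mxE deriveE// dL/= dot_delta_mx.
Qed.

(** Minorant and quadratic majorant meet at [x], so [dot (gradient f x - g)] is bounded above by
    [o(|y - x|)] and vanishes by [near_dot_eq0]. The two bounds on [F] then share one first-order
    expansion. *)
Lemma touching_gradient f F x g (M : R) :
  differentiable f x -> (forall y, f y <= F y) -> f x = F x -> 0 <= M ->
  (\forall y \near x, F y <= F x + dot g (y - x) + M * `|y - x| ^+ 2) ->
  [/\ gradient f x = g, differentiable F x & gradient F x = g].
Proof.
move=> fx fF fFx M0 FM.
have Me (e : R) : 0 < e -> \forall y \near x, M * `|y - x| ^+ 2 <= e * `|y - x|.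
  move=> e0; have : 0 < e / (M + 1) by rewrite divr_gt0// ltr_wpDl.
  move=> eM; near=> y; rewrite expr2 mulrA ler_wpM2r//.
  have : `|y - x| <= e / (M + 1).
    rewrite distrC; near: y; apply/nbhs_ballP.
    by exists (e / (M + 1)) => //= y; rewrite -ball_normE/= => /ltW.
  rewrite ler_pdivlMr ?ltr_wpDl// => /(le_trans _); apply.
  by rewrite mulrC ler_wpM2l// lerDl.
have fg : gradient f x = g.
  apply/subr0_eq/(@near_dot_eq0 x) => e e0.
  have e20 : 0 < e / 2 by rewrite divr_gt0.
  near=> y.
  have := fF y; have : F y <= F x + dot g (y - x) + M * `|y - x| ^+ 2 by near: y.
  have : M * `|y - x| ^+ 2 <= e / 2 * `|y - x| by near: y; exact: Me.
  have : `|f y - f x - dot (gradient f x) (y - x)| <= e / 2 * `|y - x|.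
    by near: y; exact: near_gradient.
  by rewrite ler_norml dotBl fFx => /andP[]; lra.
suff [] : differentiable F x /\ gradient F x = g by [].
apply: gradient_unique => e e0; near=> y.
have := fF y; have : F y <= F x + dot g (y - x) + M * `|y - x| ^+ 2 by near: y.
have : M * `|y - x| ^+ 2 <= e * `|y - x| by near: y; exact: Me.
have : `|f y - f x - dot (gradient f x) (y - x)| <= e * `|y - x|.
  by near: y; exact: near_gradient.
by rewrite fg fFx !ler_norml => /andP[]; lra.
Unshelve. all: by end_near. Qed.

End gradient_theory.

(** * The maximum function: attainment, stability of maximizers, dense differentiability *)

Section max_function.
Context {R : realType} {p : nat} {Z : ptopologicalType}.
Context (h : 'rV[R]_p -> Z -> R) (psi : Z -> R).
Hypothesis h_continuous : continuous (fun x : 'rV[R]_p * Z => h x.1 x.2).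
Hypothesis psi_coercive : coercive psi.
Hypothesis psi_ge0 : forall z, 0 <= psi z.
Hypothesis h_le : forall w z, h w z <= - psi z.

Let H (w : 'rV[R]_p) := maximum (range (h w)).

(** Coercivity confines the competition to the compact set [X]: outside it,
    [h w z <= - psi z < h w point]. *)
Lemma maximum_range w : (exists z, h w z = H w) /\ (forall z, h w z <= H w).
Proof.
pose X := [set z | psi z <= - h w point].
have Xpoint : X point by rewrite /X/= lerNr; exact: h_le.
have cX : compact X by exact: psi_coercive.
have ch : {within X, continuous (h w)}.
  apply: continuous_subspaceT => z.
  apply: (@continuous_comp _ _ _ (fun z => (w, z)) (fun x => h x.1 x.2)).
    exact: (cvg_pair (cvg_cst _) cvg_id).
  exact: h_continuous.
have [z /set_mem Xz zmax] := compact_EVT_max (ex_intro _ _ Xpoint) cX ch.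
have {}zmax t : h w t <= h w z.
  have [Xt|Xt] := leP (psi t) (- h w point).
    by apply: zmax; rewrite inE.
  rewrite (le_trans (h_le _ _))//.
  by rewrite (@le_trans _ _ (h w point)) ?zmax ?inE// lerNl ltW.
have -> : H w = h w z.
  have : (range (h w) `&` ubound (range (h w))) (h w z).
    by split; [exists z|move=> _ [t _ <-]].
  rewrite /H /maximum; case: xgetP => [y _ [[t _ <-] ub] _|/(_ (h w z))//].
  by apply/eqP; rewrite eq_le zmax ub//; exists z.
by split => //; exists z.
Qed.

Lemma maximum_attained w : exists z, h w z = H w.
Proof. by have [] := maximum_range w. Qed.

Lemma le_maximum w z : h w z <= H w.
Proof. by have [_] := maximum_range w. Qed.

Lemma maximum_le0 w : H w <= 0.
Proof. by have [z <-] := maximum_attained w; rewrite (le_trans (h_le _ _))// oppr_le0. Qed.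

(** For [d < 1], a value above [H w - d] forces [psi z <= 1 - H w]. On this compact set a covering
    argument makes uniform the local alternative: [P] holds near a maximizer, and [h] stays below
    [H w - d] near any other point. *)
Lemma near_maximizers w (P : 'rV[R]_p -> Z -> Prop) :
    (forall z, h w z = H w -> \forall w' \near w & z' \near z, P w' z') ->
  \forall w' \near w & d \near 0^'+, forall z, H w - d < h w' z -> P w' z.
Proof.
move=> HP.
have cX : compact [set z | psi z <= 1 - H w] by exact: psi_coercive.
have FF : Filter (filter_prod (nbhs w) (0 : R)^'+) by exact: filter_prod_filter.
have /compact_near_coveringP/(_ _ _ (fun i z => H w - i.2 < h i.1 z -> P i.1 z) FF) := cX.
have cov z : psi z <= 1 - H w ->
    \forall z' \near z & i \near filter_prod (nbhs w) (0 : R)^'+, H w - i.2 < h i.1 z' -> P i.1 z'.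
  move=> _; have [/HP[[U V] /= [Uw Vz] UV]|hz] := eqVneq (h w z) (H w).
    exists (V, U `*` setT) => /=.
      by split=> //; exists (U, setT) => //=; split => //; exact: filterT.
    by move=> [z' [w' d]] /= [Vz' [Uw' _]] _; exact: (UV (w', z')).
  have {}hz : h w z < H w by rewrite lt_neqAle hz le_maximum.
  (* Half the gap: [h] stays below [h w z + g = H w - g] nearby, hence below [H w - d] once
     [d < g]. *)
  pose g := (H w - h w z) / 2.
  have g0 : 0 < g by rewrite divr_gt0// subr_gt0.
  have /(_ (w, z)) /cvgrPdist_lt/(_ _ g0) [[U V] /= [Uw Vz] UV] := h_continuous.
  exists (V, U `*` [set d | d < g]) => /=.
    by split=> //; exists (U, [set d | d < g]) => //=; split => //; exact: nbhs_right_lt.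
  move=> [z' [w' d]] /= [Vz' [Uw' dg]] hd; exfalso.
  have /= := UV (w', z') (conj Uw' Vz').
  rewrite distrC ltr_norml => /andP[_]; move: hd dg; rewrite /g; lra.
move=> /(_ cov) [[U V] /= [Uw V0] UV].
exists (U, V `&` [set d | d < 1]) => /=.
  by split=> //; apply: filterI => //; apply: nbhs_right_lt.
move=> [w' d] /= [Uw' [Vd d1]] z hd; apply: (UV (w', d)) => //=.
by have := h_le w' z; lra.
Qed.

(** A maximizer of the penalized function [f] provides the paraboloid from above and the section
    [h ^~ z] from below that [touching_gradient] asks for. *)
Lemma differentiable_maximum_dense a (r : R) :
  (forall z x, differentiable (h ^~ z) x) -> 0 < r ->
  exists x z, [/\ `|x - a| < r, h x z = H x, differentiable H x
    & gradient H x = gradient (h ^~ z) x].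
Proof.
move=> dh r0.
pose q (x : 'rV[R]_p) := dot (x - a) (x - a).
(* This weight keeps the maximizer off the boundary of the ball: comparison with [(a, za)] gives [n
   * q x <= H x - H a <= - H a < n * r ^+ 2]. *)
pose n := (1 - H a) / r ^+ 2.
have n0 : 0 < n by rewrite divr_gt0 ?exprn_gt0// subr_gt0 (le_lt_trans (maximum_le0 _)).
pose B := [set x : 'rV[R]_p | `|x - a| <= r].
pose X := [set z | psi z <= - H a].
have cB : compact B.
  apply: bounded_closed_compact.
    exists (r + `|a|); split; first exact: num_real.
    move=> M rM x /= xa; rewrite (le_trans _ (ltW rM))//.
    by rewrite -[x](subrK a) (le_trans (ler_normD _ _))// lerD2r.
  have -> : B = closed_ball a r.
    by rewrite closed_ballE//; apply/seteqP; split => x; rewrite /closed_ball_/= distrC.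
  exact: closed_ball_closed.
have cBX : compact (B `*` X) by apply: compact_setX => //; exact: psi_coercive.
pose f (x : 'rV[R]_p * Z) := h x.1 x.2 - n * q x.1.
have cq : continuous q.
  apply: continuous_big => [|i _ x]; first exact: add_continuous.
  have ci : {for x, continuous (fun x : 'rV[R]_p => (x - a) 0 i)}.
    have -> : (fun x : 'rV[R]_p => (x - a) 0 i) = (fun x => x 0 i - a 0 i).
      by apply/funext => y; rewrite !mxE.
    by apply: continuousB; [exact: coord_continuous|exact: cst_continuous].
  exact: (continuousM ci ci).
have cf : continuous f.
  move=> [x z]; apply: cvgB; first exact: h_continuous.
  apply: cvgM; first exact: cvg_cst.
  apply: (@cvg_comp _ _ _ fst q _ (nbhs x)); first exact: cvg_fst.
  exact: cq.
have [za hza] := maximum_attained a.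
have aza : (B `*` X) (a, za).
  split; first by rewrite /B/= subrr normr0 ltW.
  by rewrite /X/= -hza lerNr; exact: h_le.
have qa : q a = 0 by rewrite /q subrr dot0r.
have [[x z]] := compact_EVT_max (ex_intro _ _ aza) cBX (continuous_subspaceT cf).
move=> /set_mem [/= Bx Xz] fmax.
have fa : H a <= f (x, z).
  have := fmax (a, za); rewrite inE => /(_ aza).
  by rewrite /f/= qa mulr0 subr0 hza.
(* Maximality extends from [X] to all of [Z], since outside [X] the value of [f] is below [H a]. *)
have {}fmax y t : `|y - a| <= r -> f (y, t) <= f (x, z).
  move=> yr; have [Xt|Xt] := leP (psi t) (- H a).
    by apply: fmax; rewrite inE; split.
  rewrite (le_trans _ fa)// /f/=.
  have := h_le y t; have : 0 <= n * q y by rewrite mulr_ge0 ?(ltW n0)// dot_ge0.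
  by move: Xt; lra.
have hxz : h x z = H x.
  have [t ht] := maximum_attained x; apply/eqP; rewrite eq_le le_maximum -ht.
  by have := fmax x t Bx; rewrite /f/= lerD2r.
have xr : `|x - a| < r.
  rewrite -(@ltr_pXn2r _ 2)// ?nnegrE ?(ltW r0)//.
  have qx : `|x - a| ^+ 2 <= q x.
    rewrite /q -sqr_euclidean_norm lerXn2r ?nnegrE ?euclidean_norm_ge0//.
    exact: norm_le_euclidean_norm.
  have nr : n * r ^+ 2 = 1 - H a by rewrite /n divfK// gt_eqF ?exprn_gt0.
  have : n * q x < n * r ^+ 2.
    by rewrite nr; have := maximum_le0 x; move: fa; rewrite /f/= hxz; lra.
  by rewrite ltr_pM2l//; exact: le_lt_trans.
have qE y : q y - q x = dot (2 *: (x - a)) (y - x) + dot (y - x) (y - x).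
  rewrite /q -[y - a](subrKA x) (dot_add (y - x)) dotZl (dotC (x - a) (y - x)); ring.
have hz y : h y z <= H y by exact: le_maximum.
(* Maximality read at a maximizer [t] for [y] gives [H y <= H x + n * (q y - q x)]; [qE] splits the
   increment into linear and quadratic parts, and [p%:R ^+ 2] is the price of the sup norm. *)
have nearx : \forall y \near x,
    H y <= H x + dot (n *: (2 *: (x - a))) (y - x) + n * p%:R ^+ 2 * `|y - x| ^+ 2.
  have : 0 < r - `|x - a| by rewrite subr_gt0.
  move=> rx; apply/nbhs_ballP; exists (r - `|x - a|) => //= y.
  rewrite -ball_normE/= => xy.
  have yr : `|y - a| <= r.
    rewrite -[y - a](subrKA x) (le_trans (ler_normD _ _))// distrC; lra.
  have [t ht] := maximum_attained y.
  have := fmax y t yr; rewrite /f/= ht hxz => Hyx.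
  have : dot (y - x) (y - x) <= p%:R ^+ 2 * `|y - x| ^+ 2.
    rewrite -exprMn -sqr_euclidean_norm lerXn2r ?nnegrE ?euclidean_norm_ge0//.
    exact: euclidean_norm_le.
  rewrite -(ler_pM2l n0) => ?.
  have := qE y; rewrite !dotZl; move/(congr1 (fun u => n * u)); lra.
have nM : 0 <= n * p%:R ^+ 2 by rewrite mulr_ge0 ?(ltW n0).
have [gx Hx gHx] := touching_gradient (dh z x) hz hxz nM nearx.
by exists x, z; split => //; rewrite gHx gx.
Qed.

End max_function.

(** * Mean value along a segment, extraction of limiting gradients, perturbation of slopes *)

Lemma gradient_mean_value {R : realType} {n : nat} (f : 'rV[R]_n -> R) w x :
    (forall y, differentiable f y) ->
  exists2 s, 0 <= s <= 1 &
    f x - f w = dot (gradient f (w + s *: (x - w))) (x - w).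
Proof.
move=> df; set v := x - w.
pose g (s : R) : R := f (w + s *: v).
have dg (s : R) : is_derive s 1 g (dot (gradient f (w + s *: v)) v).
  have gE : (fun h : R => h^-1 *: (g (h *: 1 + s) - g s)) =
      (fun h : R => h^-1 *: (f (h *: v + (w + s *: v)) - f (w + s *: v))).
    apply/funext => h; rewrite /g; congr (_ *: (f _ - _)).
    by rewrite scalerDl addrCA [h *: 1]mulr1.
  rewrite -diff_gradient// -deriveE//; apply: DeriveDef.
    by rewrite /derivable gE; exact: diff_derivable.
  by rewrite /derive gE.
have cg : {within `[0, 1], continuous g}.
  apply: derivable_within_continuous => s _; exact: ex_derive.
have [s s01] := MVT_segment ler01 (fun s _ => dg s) cg.
have wv : w + v = x by rewrite addrC subrK.
rewrite /g scale1r scale0r addr0 subr0 mulr1 wv => fE.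
by exists s.
Qed.

(** The set under the hull in [clarke_subdifferential], named so that the hull of its bounded part
    can be handled. *)
Definition limiting_gradient {R : realType} {n : nat} (f : 'rV[R]_n -> R)
    (w : 'rV[R]_n) : set 'rV[R]_n :=
  [set v | exists u : nat -> 'rV[R]_n,
    [/\ forall k, differentiable f (u k),
        u k @[k --> \oo] --> w
      & gradient f (u k) @[k --> \oo] --> v]].

Lemma cvg_near_harmonic {R : realType} {V : normedModType R} (u : nat -> V) (l : V) :
  (forall k, `|u k - l| < k.+1%:R^-1) -> u k @[k --> \oo] --> l.
Proof.
move=> ul; apply/cvgrPdist_lt => e e0; near=> k.
rewrite distrC (lt_trans (ul k))//; near: k; exact: near_infty_natSinv_lt (PosNum e0).
Unshelve. all: by end_near. Qed.

(** The gradients lie in a compact ball and have a cluster point there. [P] is kept at indices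
    [j >= k] instead of being passed to the limit, so no closedness is asked of it. *)
Lemma exists_limiting_gradient {R : realType} {n : nat} (f : 'rV[R]_n -> R) w
    (B : R) (P : nat -> 'rV[R]_n -> Prop) :
    (forall k : nat, exists x, [/\ `|x - w| < k.+1%:R^-1, differentiable f x,
      `|gradient f x| <= B & P k (gradient f x)]) ->
  exists2 l, limiting_gradient f w l &
    forall k : nat, exists j g, [/\ (k <= j)%N, P j g, `|g| <= B & `|g - l| < k.+1%:R^-1].
Proof.
move=> /choice[x xP].
pose g k := gradient f (x k).
pose K := [set v : 'rV[R]_n | `|v| <= B].
have cK : compact K.
  apply: bounded_closed_compact.
    exists B; split; first exact: num_real.
    by move=> M BM v /= vB; rewrite (le_trans vB)// ltW.
  rewrite (_ : K = (fun v : 'rV[R]_n => `|v|) @^-1` [set r | r <= B])//.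
  by apply: closed_comp => [v _|]; [exact: norm_continuous|exact: closed_le].
have gK : (g k @[k --> \oo]) K.
  by exists 0%N => // k _; rewrite /K/=; have [] := xP k.
have [l [Kl clg]] := cK _ _ gK.
(* The bound [k <= j] already gives the convergence of the base points; the selection [s] may fail
   to be increasing. *)
have near_l (k : nat) : exists j, (k <= j)%N /\ `|g j - l| < k.+1%:R^-1.
  have [||_ [[j /= kj <-] jl]] :=
    clg [set g j | j in [set j | (k <= j)%N]] (ball l k.+1%:R^-1).
  - by exists k => // j /= kj; exists j.
  - exact: nbhsx_ballx.
  by exists j; split => //; rewrite distrC; move: jl; rewrite -ball_normE.
have [s sP] := choice near_l.
exists l.
  exists (x \o s); split.
  - by move=> k; have [] := xP (s k).
  - apply: cvg_near_harmonic => k; have [xw _ _ _] := xP (s k).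
    rewrite (lt_le_trans xw)// lef_pV2 ?posrE// ler_nat ltnS.
    by have [] := sP k.
  - by apply: cvg_near_harmonic => k; have [] := sP k.
move=> k; exists (s k), (g (s k)); have [_ _ gB Pg] := xP (s k).
by have [ks gl] := sP k; split.
Qed.

(* D is the step x - w, and G1, G2 are the gradients that the mean value theorem
   produces for z and z0; G and g are the gradients to be compared. *)
Lemma slope_perturbation {R : realType} {n : nat}
    (D d u G G1 G2 g : 'rV[R]_n) (t e e1 B : R) :
    0 < t -> 0 < e1 -> e1 <= 1 -> 0 <= B ->
    e1 * (3 * (euclidean_norm d + 1) + (2 * B + 1)) <= e ->
    D = t *: d + u -> euclidean_norm u <= t * e1 ->
    euclidean_norm (G1 - G) <= 2 * e1 -> euclidean_norm (G2 - g) <= e1 ->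
    euclidean_norm G <= B + 1 -> euclidean_norm g <= B ->
    dot G2 D <= dot G1 D ->
  dot g d - e <= dot G d.
Proof.
move=> t0 e10 e11 B0 e1e DE ut G1G G2g GB gB ineq.
set nd := euclidean_norm d in e1e.
have nd0 : 0 <= nd by exact: euclidean_norm_ge0.
have GgB : euclidean_norm (G - g) <= 2 * B + 1.
  have := ler_euclidean_normD G (- g); rewrite euclidean_normN; lra.
have nD : euclidean_norm D <= t * (nd + e1).
  have := ler_euclidean_normD (t *: d) u.
  by rewrite -DE euclidean_normZ gtr0_norm// -/nd; lra.
have N0 := euclidean_norm_ge0 D.
have l1 : `|dot (G1 - G) D| <= 2 * e1 * (t * (nd + e1)).
  by rewrite (le_trans (dot_norm_le _ _))// ler_pM ?euclidean_norm_ge0.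
have l2 : `|dot (G2 - g) D| <= e1 * (t * (nd + e1)).
  by rewrite (le_trans (dot_norm_le _ _))// ler_pM ?euclidean_norm_ge0.
have l3 : dot (G - g) u <= (2 * B + 1) * (t * e1).
  by rewrite (le_trans (dot_le _ _))// ler_pM ?euclidean_norm_ge0.
(* Write [G - g] as [(G1 - G2) - (G1 - G) + (G2 - g)]: the first term is nonnegative along [D], the
   others cost [2 * e1] and [e1] times the length of [D]. *)
have GgD : - (3 * e1 * (t * (nd + e1))) <= dot (G - g) D.
  move: l1 l2; rewrite !ler_norml !dotBl => /andP[_ l1] /andP[l2 _]; lra.
have h1 : t * (e1 * (3 * (nd + 1) + (2 * B + 1))) <= t * e by rewrite ler_pM2l.
have h2 : 3 * e1 * (t * (nd + e1)) <= 3 * e1 * (t * (nd + 1)).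
  by rewrite ler_pM2l ?mulr_gt0// ler_pM2l// lerD2l.
move: GgD; rewrite DE (dotDr _ _ u) dotZr => GgD.
have : t * (- e) <= t * dot (G - g) d by lra.
by rewrite ler_pM2l// dotBl; lra.
Qed.

(** * Limiting gradients of the maximum function dominate the gradients at maximizers *)

Section max_function_limiting_gradients.
Context {R : realType} {p : nat} {Z : ptopologicalType}.
Context (h : 'rV[R]_p -> Z -> R) (psi : Z -> R).
Hypothesis h_continuous : continuous (fun x : 'rV[R]_p * Z => h x.1 x.2).
Hypothesis psi_coercive : coercive psi.
Hypothesis psi_ge0 : forall z, 0 <= psi z.
Hypothesis h_le : forall w z, h w z <= - psi z.
Hypothesis h_differentiable : forall z w, differentiable (h ^~ z) w.
Hypothesis gradh_continuous :
  continuous (fun x : 'rV[R]_p * Z => gradient (h ^~ x.2) x.1).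

Let H (w : 'rV[R]_p) := maximum (range (h w)).
Let gradh w z := gradient (h ^~ z) w.

Lemma near_gradh_uniform w c e : 0 < e ->
  \forall x \near w, forall z, psi z <= c -> euclidean_norm (gradh x z - gradh w z) <= e.
Proof.
move=> e0.
have cX : compact [set z | psi z <= c] by exact: psi_coercive.
(* The comparison passes through [gradh w z], whence the 2; [p.+1] converts the sup norm to the
   Euclidean one and stays positive for [p = 0]. *)
pose r := e / (2 * p.+1%:R).
have r0 : 0 < r by rewrite divr_gt0// mulr_gt0.
have /compact_near_coveringP/(_ _ (nbhs w)
  (fun x z => euclidean_norm (gradh x z - gradh w z) <= e)) := cX.
apply => z _.
have /(_ (w, z)) /cvgrPdist_lt/(_ _ r0) [[U V] /= [Uw Vz] UV] := gradh_continuous.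
exists (V, U) => //= -[z' x] /= [Vz' Ux].
have h1 := UV (x, z') (conj Ux Vz').
have h2 := UV (w, z') (conj (nbhs_singleton Uw) Vz').
rewrite (le_trans (euclidean_norm_le _))//.
have h3 : `|gradh x z' - gradh w z'| <= 2 * r.
  rewrite -(subrKA (gradh w z)) (le_trans (ler_normD _ _))// mulr_natl mulr2n.
  by apply: lerD; [rewrite distrC; exact: ltW h1|exact: ltW h2].
rewrite (le_trans (ler_wpM2l _ h3))//.
have -> : e = p.+1%:R * (2 * r) by rewrite /r; field; rewrite addrC natr1.
by rewrite ler_wpM2r ?ler_nat// mulr_ge0// ltW.
Qed.

Lemma gradh_bounded w c :
  exists2 B, 0 <= B & forall z, psi z <= c -> euclidean_norm (gradh w z) <= B.
Proof.
have cX : compact [set z | psi z <= c] by exact: psi_coercive.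
have cg : {within [set z | psi z <= c], continuous (gradh w)}.
  apply: continuous_subspaceT => z.
  apply: (@continuous_comp _ _ _ (fun z => (w, z)) (fun x => gradh x.1 x.2)).
    exact: (cvg_pair (cvg_cst _) cvg_id).
  exact: gradh_continuous.
have /ex_strict_bound_gt0[k k0 kP] := compact_bounded (continuous_compact cg cX).
exists (p%:R * k); first by rewrite mulr_ge0// ltW.
move=> z zc; rewrite (le_trans (euclidean_norm_le _))// ler_wpM2l// ltW//.
by apply: kP; exists z.
Qed.

Lemma differentiable_maximum_directional w z0 (d : 'rV[R]_p) (e r B : R) :
    h w z0 = H w -> 0 < e -> 0 < r -> 0 <= B ->
    (forall z, psi z <= 1 - H w -> euclidean_norm (gradh w z) <= B) ->
  exists x, [/\ `|x - w| < r, differentiable H x,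
    euclidean_norm (gradient H x) <= B + 1 &
    dot (gradh w z0) d - e <= dot (gradient H x) d].
Proof.
move=> hz0 e0 r0 B0 wB.
pose nd := euclidean_norm d.
have nd0 : 0 <= nd := euclidean_norm_ge0 _.
pose C := 3 * (nd + 1) + (2 * B + 1).
have C0 : 0 < C by rewrite /C; lra.
pose e1 := Num.min 1 (e / C).
have e10 : 0 < e1 by rewrite lt_min ltr01 divr_gt0.
have e11 : e1 <= 1 by rewrite ge_min lexx.
have e1e : e1 * C <= e by rewrite -ler_pdivlMr// ge_min lexx orbT.
have hcw : \forall x \near w, H w - 1 < h x z0.
  have /(_ (w, z0)) /cvgrPdist_lt/(_ _ ltr01) [[U V] /= [Uw Vz] UV] := h_continuous.
  apply: filterS Uw => x Ux; have /= := UV (x, z0) (conj Ux (nbhs_singleton Vz)).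
  by rewrite hz0 ltr_norml => /andP[_]; lra.
have [r1 [r10 r1r r1P]] : exists r1, [/\ 0 < r1, r1 <= r & forall x, `|x - w| < r1 ->
    (forall z, psi z <= 1 - H w -> euclidean_norm (gradh x z - gradh w z) <= e1) /\
    H w - 1 < h x z0].
  have : \forall x \near w, (forall z, psi z <= 1 - H w ->
      euclidean_norm (gradh x z - gradh w z) <= e1) /\ H w - 1 < h x z0.
    by apply: filterI => //; exact: near_gradh_uniform.
  move=> /nbhs_ballP[r2 /= r20 r2P].
  exists (Num.min r r2); split; first by rewrite lt_min r0.
    by rewrite ge_min lexx.
  move=> x; rewrite lt_min => /andP[_ xr2]; apply: r2P.
  by rewrite -ball_normE/= distrC.
pose t := r1 / (2 * (`|d| + 1)).
have d10 : 0 < `|d| + 1 by rewrite ltr_wpDl.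
have t0 : 0 < t by rewrite divr_gt0// mulr_gt0.
have td : t * `|d| <= r1 / 2.
  have -> : r1 / 2 = t * (`|d| + 1) by rewrite /t; field; rewrite gt_eqF.
  by rewrite ler_pM2l// lerDl.
(* The first bound keeps [x] within [r1] of [w]; the second makes the deviation from [w + t *: d] at
   most [t * e1], still small after division by [t]. *)
pose r2 := Num.min (r1 / 2) (t * e1 / p.+1%:R).
have r20 : 0 < r2 by rewrite lt_min !divr_gt0// mulr_gt0.
have [x [z [xa hxz Hx gHx]]] := differentiable_maximum_dense h_continuous
  psi_coercive psi_ge0 h_le (w + t *: d) h_differentiable r20.
pose u := x - (w + t *: d).
have xwE : x - w = t *: d + u by rewrite [RHS]addrC /u opprD addrA subrK.
have xw : `|x - w| < r1.
  have : `|u| < r1 / 2 by rewrite (lt_le_trans xa)// ge_min lexx.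
  have : `|t *: d| = t * `|d| by rewrite normrZ gtr0_norm.
  by have := ler_normD (t *: d) u; rewrite xwE; lra.
have nu : euclidean_norm u <= t * e1.
  have : `|u| <= t * e1 / p.+1%:R by rewrite (le_trans (ltW xa))// ge_min lexx orbT.
  rewrite ler_pdivlMr// mulrC => up; rewrite (le_trans (euclidean_norm_le _))//.
  by rewrite (le_trans _ up)// ler_wpM2r// ler_nat.
have segment s : 0 <= s <= 1 -> `|w + s *: (x - w) - w| < r1.
  move=> /andP[s0 s1]; rewrite addrC addKr normrZ ger0_norm//.
  by rewrite (le_lt_trans _ xw)// ler_piMl.
(* Since [h x z = H x >= h x z0 > H w - 1], the bound by [- psi] puts [z] in the sublevel set where
   gradients are controlled. *)
have Xz : psi z <= 1 - H w.
  have [_ ] := r1P _ xw; have := le_maximum h_continuous psi_coercive h_le x z0.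
  by rewrite -hxz; have := h_le x z; lra.
have Xz0 : psi z0 <= 1 - H w by rewrite -hz0; have := h_le w z0; lra.
have close y z' : `|y - w| < r1 -> psi z' <= 1 - H w ->
    euclidean_norm (gradh y z' - gradh w z') <= e1.
  by move=> /r1P[+ _] => /[apply].
have [s1 s1P m1] := gradient_mean_value w x (h_differentiable z).
have [s2 s2P m2] := gradient_mean_value w x (h_differentiable z0).
set G := gradh x z; set g := gradh w z0.
set G1 := gradient _ _ in m1; set G2 := gradient _ _ in m2.
(* Optimality of [z] at [x] and of [z0] at [w], written with the two mean value identities. *)
have ineq : dot G2 (x - w) <= dot G1 (x - w).
  by rewrite -m1 -m2 hxz hz0 lerB//; apply: (le_maximum h_continuous psi_coercive h_le).
have Gw : euclidean_norm (G - gradh w z) <= e1 by exact: close.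
have G1G : euclidean_norm (G1 - G) <= 2 * e1.
  rewrite -(subrKA (gradh w z)) mulr_natl mulr2n.
  apply: (le_trans (ler_euclidean_normD _ _)); apply: lerD.
    by apply: close; [exact: segment|].
  by rewrite -opprB euclidean_normN.
have G2g : euclidean_norm (G2 - g) <= e1 by apply: close => //; exact: segment.
have GB : euclidean_norm G <= B + 1.
  rewrite -[G](subrK (gradh w z)) (le_trans (ler_euclidean_normD _ _))//.
  by rewrite addrC lerD ?wB// (le_trans Gw).
have gB : euclidean_norm g <= B by exact: wB.
exists x; split; [exact: lt_le_trans xw r1r|exact: Hx|by rewrite gHx|].
by rewrite gHx; exact: (slope_perturbation t0 _ _ _ _ xwE nu G1G G2g GB gB ineq).
Qed.

(** Limit of [differentiable_maximum_directional] as the tolerances vanish. [l] may depend on [d],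
    but [B] comes before [z0] and [d], as the bounded set in [near_convex_hull] requires. *)
Lemma limiting_gradient_maximum w : exists B, forall z0 d, h w z0 = H w ->
  exists l, [/\ limiting_gradient H w l, euclidean_norm l <= B
    & dot (gradh w z0) d <= dot l d].
Proof.
have [B B0 wB] := gradh_bounded w (1 - H w).
exists (p%:R * (B + 2)) => z0 d hz0.
pose P (k : nat) g := dot (gradh w z0) d - k.+1%:R^-1 <= dot g d.
have [|l Hl lP] := @exists_limiting_gradient _ _ H w (B + 1) P.
  move=> k; have k0 : 0 < k.+1%:R^-1 :> R by rewrite invr_gt0.
  have [x [xw Hx gB gd]] := differentiable_maximum_directional d hz0 k0 k0 B0 wB.
  exists x; split => //; exact: le_trans (norm_le_euclidean_norm _) gB.
exists l; split => //.
  have [j [g [_ _ gB gl]]] := lP 0%N.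
  rewrite (le_trans (euclidean_norm_le _))// ler_wpM2l//.
  rewrite -[l](subrK g) (le_trans (ler_normD _ _))// distrC.
  by move: gB gl; rewrite invr1; lra.
(* The first summand pays for replacing [g] by [l], the 1 for the slack in [P]. *)
pose C := euclidean_norm d * p%:R + 1.
have C0 : 0 < C by rewrite ltr_wpDl// mulr_ge0// euclidean_norm_ge0.
apply/ler_addgt0Pr => e e0.
have eC0 : 0 < e / C by rewrite divr_gt0.
have [k ke] := filter_ex (near_infty_natSinv_lt (PosNum eC0)).
have {}ke : C * k.+1%:R^-1 <= e by rewrite mulrC -ler_pdivlMr// ltW.
have [j [g [kj Pg _ gl]]] := lP k.
have jk : j.+1%:R^-1 <= k.+1%:R^-1 :> R by rewrite lef_pV2 ?posrE// ler_nat.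
have : `|dot (g - l) d| <= euclidean_norm d * p%:R * k.+1%:R^-1.
  rewrite (le_trans (dot_norm_le _ _))// mulrC -mulrA ler_wpM2l ?euclidean_norm_ge0//.
  by rewrite (le_trans (euclidean_norm_le _))// ler_wpM2l// ltW.
rewrite ler_norml dotBl => /andP[_].
rewrite /C mulrDl mul1r in ke; rewrite /P in Pg; move: ke Pg jk.
by move: (k.+1%:R^-1) (j.+1%:R^-1) => a b; lra.
Qed.

End max_function_limiting_gradients.

(** * Gibbs measures at fixed parameters: normalization, tails, mean gradient *)

Section gibbs_measure.
Context {R : realType} {d : measure_display} {T : measurableType d}.
Context (pi0 : probability T R) {p : nat} (h : 'rV[R]_p -> T -> R).
Context (beta : R) (w : 'rV[R]_p).
Hypothesis beta_gt0 : 0 < beta.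
Hypothesis mh : measurable_fun setT (h w).
Hypothesis h_le0 : forall z, h w z <= 0.

Let I := \int[pi0]_u expR (h w u / beta).

Let mE : measurable_fun setT (fun z => expR (h w z / beta)).
Proof.
by apply: measurableT_comp => //; apply: measurable_funM => //; exact: measurable_cst.
Qed.

Let E_le1 z : expR (h w z / beta) <= 1.
Proof. by rewrite -expR0 ler_expR pmulr_lle0// invr_gt0. Qed.

Let intE : pi0.-integrable setT (fun z => (expR (h w z / beta))%:E).
Proof.
apply: (@le_integrable _ _ _ _ _ measurableT _ (EFin \o cst 1)).
- exact/measurable_EFinP.
- by move=> z _; rewrite /= lee_fin !ger0_norm ?expR_ge0// E_le1.
- exact: finite_measure_integrable_cst.
Qed.

(** Laplace-type lower bound: only the contribution of [A] to the integral is kept. *)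
Lemma partition_function_ge (A : set T) m : measurable A ->
  (forall z, A z -> m <= h w z) -> expR (m / beta) * fine (pi0 A) <= I.
Proof.
move=> mA mh'.
have mA1 : pi0.-integrable setT (EFin \o (fun z => expR (m / beta) * \1_A z)).
  apply: (@le_integrable _ _ _ _ _ measurableT _ (EFin \o cst (expR (m / beta)))).
  - by apply/measurable_EFinP; apply: measurable_funM => //; exact: measurable_cst.
  - move=> z _; rewrite /= lee_fin !ger0_norm ?mulr_ge0 ?expR_ge0//.
    by rewrite ler_piMr ?expR_ge0// indicE; case: (_ \in _).
  - exact: finite_measure_integrable_cst.
have -> : expR (m / beta) * fine (pi0 A) = \int[pi0]_z (expR (m / beta) * \1_A z).
  rewrite /Rintegral; under eq_integral do rewrite EFinM.
  rewrite ge0_integralZl//; last exact/measurable_EFinP.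
  by rewrite integral_indic// setIT fineM// fin_num_measure.
apply: (le_Rintegral measurableT mA1 intE) => z _; rewrite indicE.
have [/set_mem Az|_] := boolP (z \in A); last by rewrite mulr0 expR_ge0.
by rewrite mulr1 ler_expR ler_pM2r ?invr_gt0// mh'.
Qed.

Hypothesis I_gt0 : 0 < I.

Let density_ge0 z : 0 <= gibbs_density pi0 h beta w z.
Proof. by rewrite divr_ge0 ?expR_ge0// ltW. Qed.

Let mdensity : measurable_fun setT (gibbs_density pi0 h beta w).
Proof. by apply: measurable_funM => //; exact: measurable_cst. Qed.

(** [gibbs] is a bare set function; packing it as a probability gives access to the linearity and
    monotonicity of integrals. *)
Lemma gibbs_probability :
  exists nu : probability T R, nu = gibbs pi0 h beta w :> (set T -> \bar R).
Proof.
pose nu := gibbs pi0 h beta w.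
have nu0 : nu set0 = 0%E by rewrite /nu /gibbs integral_set0.
have nu_ge0 A : (0 <= nu A)%E by apply: integral_ge0 => z _; rewrite lee_fin.
have nu_sigma : semi_sigma_additive nu.
  apply: semi_sigma_additive_nng_induced => [|z]; last by rewrite lee_fin.
  exact/measurable_EFinP.
have nuT : nu setT = 1%E.
  rewrite /nu /gibbs /gibbs_density.
  under eq_integral do rewrite mulrC EFinM.
  rewrite integralZl//.
  have -> : (\int[pi0]_x (expR (h w x / beta))%:E)%E = I%:E.
    by rewrite /I /Rintegral fineK//; exact: integrable_fin_num.
  by rewrite -EFinM mulVf ?gt_eqF.
pose M := isMeasure.Build d T R nu nu0 nu_ge0 nu_sigma.
pose P := Measure_isProbability.Build d T R
  (HB.pack_for {measure set T -> \bar R} nu M) nuT.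
by exists (HB.pack_for (probability T R) nu M P).
Qed.

(** On the low set the density is at most [expR (M / beta) / I], so the restricted Gibbs measure is
    dominated by that multiple of [pi0]. *)
Lemma gibbs_tail (nu : probability T R) (M : R) (f : T -> \bar R) :
    nu = gibbs pi0 h beta w :> (set T -> \bar R) ->
    measurable_fun setT f -> (forall z, 0 <= f z)%E ->
  (\int[nu]_(z in [set z | (h w z <= M)%R]) f z <=
   (expR (M / beta) / I)%:E * \int[pi0]_z f z)%E.
Proof.
move=> nuE mf f0.
pose D := [set z | h w z <= M].
have mD : measurable D.
  have -> : D = h w @^-1` `]-oo, M] by apply/seteqP; split => z /=; rewrite in_itv.
  by rewrite -[X in measurable X]setTI; exact: mh.
have k0 : 0 <= expR (M / beta) / I by rewrite divr_ge0 ?expR_ge0// ltW.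
rewrite (@eq_measure_integral _ _ _ _ (mrestr nu mD)); last first.
  by move=> A mA AD; rewrite /= /mrestr setIidl.
have le_nu S : measurable S -> (mrestr nu mD S <= mscale (NngNum k0) pi0 S)%E.
  move=> mS; have mSD : measurable (S `&` D) by exact: measurableI.
  rewrite /= /mrestr /mscale nuE /gibbs/=.
  apply: (@le_trans _ _ (\int[pi0]_(z in S `&` D) (expR (M / beta) / I)%:E)%E).
    apply: ge0_le_integral => //.
    - by move=> z _; rewrite lee_fin.
    - by apply/measurable_EFinP; exact: measurable_funTS.
    - move=> z [_ Dz]; rewrite lee_fin ler_pM2r ?invr_gt0// ler_expR.
      by rewrite ler_pM2r ?invr_gt0.
  rewrite integral_cst// lee_wpmul2l ?lee_fin//.
  by apply: le_measure; rewrite ?inE.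
apply: (le_trans (ge0_le_measure_integral le_nu mD f0 mf)).
rewrite ge0_integral_mscale//=; last exact: measurable_funTS.
rewrite lee_wpmul2l ?lee_fin//.
exact: ge0_subset_integral.
Qed.

(** Above level [M] the slope bound is assumed; below it the growth bound is integrated with
    [gibbs_tail]. As [s] may be negative, [K] compensates for it on the low set. *)
Lemma gibbs_mean_gradient_dot_le (Psi : T -> R) (M K c s e : R) (v : 'rV[R]_p) :
    (forall i, measurable_fun setT (fun z => gradient (h ^~ z) w 0 i)) ->
    measurable_fun setT Psi -> (forall z, 0 <= Psi z) -> 0 <= K -> 0 <= c ->
    pi0.-integrable setT (EFin \o Psi) ->
    (forall z, euclidean_norm (gradient (h ^~ z) w) <= c * Psi z) ->
    (forall z, M < h w z ->
      dot (gradient (h ^~ z) w) v <= s + e * euclidean_norm v) ->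
    - (K * euclidean_norm v) <= s -> 0 <= e ->
  dot (gibbs_mean_gradient pi0 h beta w) v <=
  s + e * euclidean_norm v +
  euclidean_norm v * (expR (M / beta) / I * \int[pi0]_z (K + c * Psi z)).
Proof.
move=> mg mPsi Psi0 K0 c0 iPsi gPsi good sK e0.
have [nu nuE] := gibbs_probability.
pose g z := gradient (h ^~ z) w.
pose n := euclidean_norm v; have n0 : 0 <= n by exact: euclidean_norm_ge0.
have inu : nu.-integrable setT (EFin \o Psi).
  apply/integrableP; split; first exact/measurable_EFinP.
  (* Since [h w] is nonpositive, the tail estimate at level 0 covers the whole space and transfers
     integrability from [pi0] to [nu]. *)
  have -> : setT = [set z | h w z <= 0] by apply/seteqP; split => z //= _.
  under eq_integral do rewrite /= ger0_norm//.
  apply: (le_lt_trans (gibbs_tail _ nuE _ _)) => //.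
    exact/measurable_EFinP.
  rewrite -[X in (_ * X)%E]fineK; first by rewrite -EFinM ltry.
  exact: integrable_fin_num.
have icPsi : nu.-integrable setT (EFin \o (fun z => c * Psi z)).
  exact: (integrableZl measurableT _ inu).
have ig i : nu.-integrable setT (EFin \o (fun z => g z 0 i)).
  apply: le_integrable icPsi => //; first exact/measurable_EFinP.
  move=> z _; rewrite /= lee_fin [leRHS]ger0_norm ?mulr_ge0//.
  exact: le_trans (coord_le_euclidean_norm _ _) (gPsi z).
have igv i : nu.-integrable setT (EFin \o (fun z => g z 0 i * v 0 i)).
  exact: (integrableZr measurableT _ (ig i)).
have dotE : dot (gibbs_mean_gradient pi0 h beta w) v = \int[nu]_z dot (g z) v.
  rewrite /Rintegral /dot.
  under [in RHS]eq_integral do rewrite -sumEFin.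
  rewrite integral_sum// -sum_fine; last first.
    by move=> i _; apply: (integrable_fin_num measurableT); exact: igv.
  apply: eq_bigr => i _; rewrite mxE -nuE.
  under [in RHS]eq_integral do rewrite EFinM.
  rewrite integralZr//; last exact: ig.
  by rewrite fineM//; exact: (integrable_fin_num measurableT (ig i)).
pose D := [set z | h w z <= M].
have mD : measurable D.
  have -> : D = h w @^-1` `]-oo, M] by apply/seteqP; split => z /=; rewrite in_itv.
  by rewrite -[X in measurable X]setTI; exact: mh.
pose f z := K + c * Psi z.
have f0 z : 0 <= f z by rewrite addr_ge0// mulr_ge0.
pose b := f \_ D.
have if_nu (mu : probability T R) : mu.-integrable setT (EFin \o Psi) ->
    mu.-integrable setT (EFin \o f).
  move=> iP; have -> : EFin \o f =
      ((EFin \o cst K) \+ (fun z => c%:E * (EFin \o Psi) z)%E)%E.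
    by apply/funext => z.
  apply: integrableD => //; first exact: finite_measure_integrable_cst.
  exact: (integrableZl measurableT _ iP).
have mf : measurable_fun setT (EFin \o f) by have /integrableP[] := if_nu _ inu.
have ib : nu.-integrable setT (EFin \o b).
  rewrite /b -restrict_EFin; apply: (iffLR (integrable_mkcond _ mD)).
  exact: (integrableS measurableT mD (@subsetT _ _) (if_nu _ inu)).
have bE : \int[nu]_z b z <= expR (M / beta) / I * \int[pi0]_z f z.
  have ifin : (\int[pi0]_z (f z)%:E)%E \is a fin_num.
    by apply: integrable_fin_num => //; exact: if_nu.
  have -> : expR (M / beta) / I * \int[pi0]_z f z =
      fine ((expR (M / beta) / I)%:E * \int[pi0]_z (f z)%:E)%E by rewrite fineM.
  apply: fine_le; first exact: integrable_fin_num ib.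
    by rewrite fin_numM.
  have -> : (\int[nu]_z (b z)%:E = \int[nu]_(z in D) (f z)%:E)%E.
    by rewrite [RHS]integral_mkcond restrict_EFin.
  by apply: gibbs_tail => // z; rewrite lee_fin.
have pointwise z : dot (g z) v <= (s + e * n) + n * b z.
  rewrite /b patchE; case: ifPn => [/set_mem Dz|Dz].
    rewrite /f; have := dot_le (g z) v; have := gPsi z; rewrite -/(g z) -/n.
    have en : 0 <= e * n by rewrite mulr_ge0.
    move=> h1 h2; have : euclidean_norm (g z) * n <= c * Psi z * n by rewrite ler_wpM2r.
    move: sK; rewrite -/n; lra.
  rewrite mulr0 addr0; apply: good; rewrite ltNge; apply: contraNN Dz => Dz.
  exact/mem_set.
rewrite dotE -/n.
have inb : nu.-integrable setT (EFin \o (fun z => n * b z)).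
  exact: (integrableZl measurableT _ ib).
have ic : nu.-integrable setT (EFin \o cst (s + e * n)).
  exact: finite_measure_integrable_cst.
have : \int[nu]_z dot (g z) v <= \int[nu]_z (cst (s + e * n) z + n * b z).
  apply: le_Rintegral => //.
  - have -> : EFin \o (fun z => dot (g z) v) =
        (fun z => \sum_(i < p) (EFin \o (fun z => (g z 0 i * v 0 i)%R)) z)%E.
      by apply/funext => z /=; rewrite sumEFin.
    exact: integrable_sum.
  - exact: (integrableD measurableT ic inb).
move=> /le_trans; apply.
rewrite RintegralD// RintegralZl//.
have -> : \int[nu]_x cst (s + e * n) x = s + e * n.
  rewrite Rintegral_cst// [X in _ * fine X](_ : _ = 1%E) ?mulr1//.
  exact: probability_setT.
by rewrite lerD2l ler_wpM2l.
Qed.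

End gibbs_measure.

(** * Borel measurability of continuous functions *)

Section borel_sigma_algebra.
Context {R : realType} {Z : ptopologicalType}.

Lemma open_borel_measurable (U : set Z) : open U -> measurable (U : set (borel Z)).
Proof. exact: sub_sigma_algebra. Qed.

Lemma continuous_borel_measurable (f : Z -> R) :
  continuous f -> measurable_fun setT (f : borel Z -> R).
Proof.
move=> /continuousP cf; apply: (measurability _ (RGenOpens.measurableE R)).
move=> _ [_ [a [b ->] <-]]; rewrite setTI; apply: open_borel_measurable.
exact/cf/interval_open.
Qed.

End borel_sigma_algebra.

(** * Concentration of the mean gradient near the maximizers *)

Section gibbs_concentration.
Context {R : realType} {p : nat} {Z : ptopologicalType}.
Context (pi0 : probability (borel Z) R).
Context (h : 'rV[R]_p -> Z -> R) (psi Psi : Z -> R) (C : 'rV[R]_p -> R).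
Hypothesis pi0_support : measure_support pi0 = [set: Z].
Hypothesis h_continuous : continuous (fun x : 'rV[R]_p * Z => h x.1 x.2).
Hypothesis psi_coercive : coercive psi.
Hypothesis psi_ge0 : forall z, 0 <= psi z.
Hypothesis h_le : forall w z, h w z <= - psi z.
Hypothesis gradh_continuous :
  continuous (fun x : 'rV[R]_p * Z => gradient (h ^~ x.2) x.1).
Hypothesis Psi_continuous : continuous Psi.
Hypothesis Psi_ge0 : forall z, 0 <= Psi z.
Hypothesis Psi_integrable : pi0.-integrable setT (EFin \o Psi).
Hypothesis C_bounded : locally_bounded C.
Hypothesis gradh_le : forall w z, euclidean_norm (gradient (h ^~ z) w) <= C w * Psi z.

Let H (w : 'rV[R]_p) := maximum (range (h w)).
Let gradh w z := gradient (h ^~ z) w.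

(** The neighbourhoods are chosen before [v] and [s], so that all directions can be tested at one
    pair of [w'] and [beta]. Half of [e] pays for the gradients near the maximizers, half for the
    tail. *)
Lemma gibbs_mean_gradient_near w e : 0 < e ->
  \forall w' \near w & beta \near 0^'+, forall v s,
    (forall z, h w z = H w -> dot (gradh w z) v <= s) ->
    dot (gibbs_mean_gradient pi0 h beta w') v <= s + e * euclidean_norm v.
Proof.
move=> e0; have e20 : 0 < e / 2 by rewrite divr_gt0.
have hw_cont w' : continuous (h w').
  move=> z; apply: (@continuous_comp _ _ _ (fun z => (w', z)) (fun x => h x.1 x.2)).
    exact: (cvg_pair (cvg_cst _) cvg_id).
  exact: h_continuous.
have gradhw_cont w' : continuous (gradh w').
  move=> z; apply: (@continuous_comp _ _ _ (fun z => (w', z)) (fun x => gradh x.1 x.2)).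
    exact: (cvg_pair (cvg_cst _) cvg_id).
  exact: gradh_continuous.
pose P w' z := exists2 a, h w a = H w &
  euclidean_norm (gradh w' z - gradh w a) <= e / 2.
have nearP z : h w z = H w -> \forall w' \near w & z' \near z, P w' z'.
  move=> hz; pose r := e / 2 / p.+1%:R.
  have r0 : 0 < r by rewrite divr_gt0.
  have /(_ (w, z)) /cvgrPdist_lt/(_ _ r0) [[U V] /= [Uw Vz] UV] := gradh_continuous.
  exists (U, V) => //= -[w' z'] /= [Uw' Vz'].
  exists z => //; have /= h1 := UV (w', z') (conj Uw' Vz').
  rewrite (le_trans (euclidean_norm_le _))// distrC.
  have -> : e / 2 = p.+1%:R * r by rewrite /r [RHS]mulrC divfK.
  by apply: ler_pM => //; [rewrite ler_nat|exact: ltW h1].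
have [[U V] /= [Uw V0] UV] := near_maximizers h_continuous psi_coercive h_le nearP.
have [d [Vd d0]] : exists d, V d /\ 0 < d.
  apply: (@filter_ex _ (0 : R)^'+); apply: filterI => //; exact: nbhs_right_gt.
have [z0 hz0] := maximum_attained h_continuous psi_coercive h_le w.
have d20 : 0 < d / 2 by rewrite divr_gt0.
(* Near [z0] the values exceed [H w - d / 2], strictly above the tail level [H w - d]; full support
   gives this neighbourhood a positive mass [c]. *)
have /(_ (w, z0)) /cvgrPdist_lt/(_ _ d20) [[U1 O1] /= [U1w O1z0] UO1] := h_continuous.
pose O := interior O1.
have oO : open O by exact: open_interior.
have Oz0 : O z0 by exact: O1z0.
have mO : measurable (O : set (borel Z)) by exact: open_borel_measurable.
have piO : (0 < pi0 O)%E.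
  have : measure_support pi0 z0 by rewrite pi0_support.
  by apply; split.
pose c := fine (pi0 O).
have c0 : 0 < c by rewrite fine_gt0// piO -ge0_fin_numE// fin_num_measure.
have [Cb Cb0 nearC] : exists2 Cb, 0 <= Cb & \forall w' \near w, C w' <= Cb.
  have /ex_bound[Cb CbP] := C_bounded w.
  exists `|Cb|; first by [].
  apply: filterS CbP => w' Cw'; rewrite (le_trans _ (ler_norm _))//.
  by rewrite (le_trans (ler_norm _))// (le_trans Cw')// ler_norm.
(* As [z0] is a maximizer, [s] is at least [dot (gradh w z0) v], hence at least [- K] times the norm
   of [v]. *)
pose K := euclidean_norm (gradh w z0).
have K0 : 0 <= K by exact: euclidean_norm_ge0.
pose J := \int[pi0]_z (K + Cb * Psi z).
have J0 : 0 <= J by apply: Rintegral_ge0 => z _; rewrite addr_ge0// mulr_ge0.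
(* With [y = d / (2 b)], the tail is at most [J / (c * expR y)]; since [expR y >= 1 + y], it falls
   below [e / 2] once [c * e * y >= 2 * (J + 1)], which [b < b0] ensures. *)
pose b0 := d * c * e / (4 * (J + 1)).
have b00 : 0 < b0 by rewrite divr_gt0 ?mulr_gt0// ltr_wpDl.
exists (U `&` U1 `&` [set w' | C w' <= Cb], [set b | 0 < b] `&` [set b | b < b0]) => /=.
  split; first by apply: filterI => //; apply: filterI.
  by apply: filterI; [exact: nbhs_right_gt|exact: nbhs_right_lt].
move=> [w' b] /= [[[Uw' U1w'] Cw'] [bgt0 bb0]] v s sP.
pose I := \int[pi0]_u expR (h w' u / b).
have mh : measurable_fun setT (h w' : borel Z -> R) by exact: continuous_borel_measurable.
have h_le0 z : h w' z <= 0 by rewrite (le_trans (h_le _ _))// oppr_le0.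
have Ige : expR ((H w - d / 2) / b) * c <= I.
  apply: partition_function_ge => // z Oz.
  have /= := UO1 (w', z) (conj U1w' (interior_subset Oz)).
  by rewrite hz0 ltr_norml => /andP[_]; rewrite ltrBlDr -ltrBlDl => /ltW.
have I0 : 0 < I by rewrite (lt_le_trans _ Ige)// mulr_gt0// expR_gt0.
have gP z : euclidean_norm (gradient (h ^~ z) w') <= Cb * Psi z.
  by rewrite (le_trans (gradh_le _ _))// ler_wpM2r.
have n0 : 0 <= euclidean_norm v by exact: euclidean_norm_ge0.
have := @gibbs_mean_gradient_dot_le _ _ _ pi0 p h b w' bgt0 mh h_le0 I0
  Psi (H w - d) K Cb s (e / 2) v.
move=> /(_ _ _ Psi_ge0 K0 Cb0 Psi_integrable gP) le_dot.
have tail : expR ((H w - d) / b) / I * J <= e / 2.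
  pose y := d / 2 / b; have y0 : 0 < y by rewrite divr_gt0.
  have yJ : 2 * (J + 1) <= c * e * y.
    have -> : c * e * y = d * c * e / 2 / b by rewrite /y; field; rewrite gt_eqF.
    rewrite ler_pdivlMr// -ler_pdivlMl ?mulr_gt0// ?ltr_wpDl//.
    rewrite (le_trans (ltW bb0))// /b0 le_eqVlt; apply/orP; left; apply/eqP.
    by field; rewrite gt_eqF// ltr_wpDl.
  have HE : expR ((H w - d) / b) = expR ((H w - d / 2) / b) * (expR y)^-1.
    by rewrite -expRN -expRD; congr expR; rewrite /y; field; rewrite gt_eqF.
  have Ey : 1 + y <= expR y by exact: expR_ge1Dx.
  have E0 : 0 < expR y by exact: expR_gt0.
  have le1 : expR ((H w - d) / b) / I <= (c * expR y)^-1.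
    rewrite ler_pdivrMr// HE invfM (le_trans _ (ler_wpM2l _ Ige))//; last first.
      by rewrite mulr_ge0// invr_ge0 ltW.
    rewrite le_eqVlt; apply/orP; left; apply/eqP.
    by field; rewrite !gt_eqF.
  rewrite (le_trans (ler_wpM2r J0 le1))// mulrC ler_pdivrMr ?mulr_gt0//.
  have : c * e * (1 + y) <= c * e * expR y by rewrite ler_wpM2l// mulr_ge0// ltW.
  have : 0 < c * e by rewrite mulr_gt0.
  by lra.
have good z : H w - d < h w' z ->
    dot (gradient (h ^~ z) w') v <= s + e / 2 * euclidean_norm v.
  move=> hz; have [|a ha aP] := UV (w', d) _ z hz; first by split.
  have := dot_le (gradh w' z - gradh w a) v; have := sP a ha.
  have := ler_wpM2r n0 aP; rewrite dotBl /gradh; lra.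
have sK : - (K * euclidean_norm v) <= s.
  have := dot_norm_le (gradh w z0) v; have := sP z0 hz0.
  by rewrite ler_norml => ? /andP[+ _]; rewrite -/K; lra.
have mg i : measurable_fun setT ((fun z => gradient (h ^~ z) w' 0 i) : borel Z -> R).
  apply: continuous_borel_measurable => z.
  apply: (@continuous_comp _ _ _ (gradh w') (fun v => v 0 i)) => //.
    exact: gradhw_cont.
  exact: coord_continuous.
have mPsi : measurable_fun setT (Psi : borel Z -> R).
  exact: continuous_borel_measurable.
apply: (le_trans (le_dot mg mPsi good sK (ltW e20))).
rewrite -/I -/J -addrA lerD2l [leRHS](_ : _ =
  e / 2 * euclidean_norm v + euclidean_norm v * (e / 2)).
  by rewrite lerD2l ler_wpM2l.
by field.
Qed.

End gibbs_concentration.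

(** * Excess distance, integrability, and the convergence of the graphs *)

Lemma euclidean_norm_row_mx {R : realType} {n m : nat} (u : 'rV[R]_n) (v : 'rV[R]_m) :
  euclidean_norm (row_mx u v) <= euclidean_norm u + euclidean_norm v.
Proof.
rewrite -(@ler_pXn2r _ 2)// ?nnegrE ?addr_ge0 ?euclidean_norm_ge0//.
have -> : euclidean_norm (row_mx u v) ^+ 2 =
    euclidean_norm u ^+ 2 + euclidean_norm v ^+ 2.
  rewrite !sqr_euclidean_norm /dot big_split_ord/=.
  by congr (_ + _); apply: eq_bigr => i _; rewrite ?row_mxEl ?row_mxEr.
by rewrite sqrrD lerD2r lerDl mulrn_wge0// mulr_ge0 ?euclidean_norm_ge0.
Qed.

Lemma excess_ge0 {R : realType} {n : nat} (A B : set 'rV[R]_n) : (0 <= excess A B)%E.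
Proof. by apply: ereal_sup_ubound; left. Qed.

Lemma excess_le {R : realType} {n : nat} (A B : set 'rV[R]_n) (e : R) : 0 <= e ->
  (forall a, A a -> exists2 b, B b & euclidean_norm (a - b) <= e) ->
  (excess A B <= e%:E)%E.
Proof.
move=> e0 AB; apply: ge_ereal_sup => _ [->|[a Aa <-]]; first by rewrite lee_fin.
have [b Bb abe] := AB a Aa.
rewrite (@le_trans _ _ (euclidean_norm (a - b))%:E)//.
by apply: ereal_inf_lbound; exists b.
Qed.

Lemma ge0_ecvg0 {R : realType} {T : Type} (F : set_system T) {FF : Filter F}
    (f : T -> \bar R) : (forall t, 0 <= f t)%E ->
  (forall e : R, 0 < e -> \forall t \near F, (f t <= e%:E)%E) -> f @ F --> 0%E.
Proof.
move=> f0 fe; apply/fine_cvgP; split.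
  apply: filterS (fe 1 ltr01) => t ft.
  by rewrite ge0_fin_numE// (le_lt_trans ft)// ltry.
apply/cvgrPdist_le => e e0; apply: filterS (fe e e0) => t ft.
have fint : f t \is a fin_num by rewrite ge0_fin_numE// (le_lt_trans ft)// ltry.
by rewrite sub0r normrN ger0_norm ?fine_ge0//= -lee_fin fineK.
Qed.

(** For [a >= 1] one has [f <= 1 + f ^ a], and constants are integrable for a probability. *)
Lemma integrable_of_powR {d : measure_display} {T : measurableType d} {R : realType}
    (mu : probability T R) (f : T -> R) (a : R) :
  1 <= a -> measurable_fun setT f -> (forall z, 0 <= f z) ->
  (\int[mu]_z (f z `^ a)%:E < +oo)%E -> mu.-integrable setT (EFin \o f).
Proof.
move=> a1 mf f0 fa; apply/integrableP; split; first exact/measurable_EFinP.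
have mfa : measurable_fun setT (fun z => (f z `^ a)%:E).
  apply/measurable_EFinP; exact: (measurableT_comp (measurable_powR _)).
apply: (@le_lt_trans _ _ (\int[mu]_z (1%:E + (f z `^ a)%:E))%E).
  apply: ge0_le_integral => //.
  - by apply: measurableT_comp => //; exact/measurable_EFinP.
  - exact: (emeasurable_funD (measurable_cst _) mfa).
  - move=> z _; rewrite /= ger0_norm// -EFinD lee_fin.
    have [f1|f1] := leP (f z) 1; first by rewrite (le_trans f1)// lerDl powR_ge0.
    rewrite -{1}[f z]powRr1// (le_trans (ler_powR (ltW f1) a1))//.
    by rewrite lerDr.
rewrite ge0_integralD//; last by move=> z _; rewrite lee_fin powR_ge0.
rewrite (_ : (\int[mu]_x 1)%E = 1%E).
  by rewrite lte_add_pinfty// ltry.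
by rewrite integral_cst// mul1e; exact: probability_setT.
Qed.

Theorem theorem3p1 (R : realType) (p : nat)
    (Z : completePseudoMetricType R)
    (Z_hausdorff : hausdorff_space Z) (Z_separable : separable Z)
    (pi0 : probability (borel Z) R)
    (h : 'rV[R]_p -> Z -> R)
    (H1 : measure_support pi0 = [set: Z])
    (H2 : continuous (fun x : 'rV[R]_p * Z => h x.1 x.2))
    (H3 : exists (eta : R) (psi : Z -> R) (kappa : 'rV[R]_p -> R),
      [/\ 0 < eta,
          [/\ continuous psi, coercive psi & forall z, 0 <= psi z],
          locally_bounded kappa /\ (forall w, 1 <= kappa w),
          (\int[pi0]_z (psi z `^ (1 + eta))%:E < +oo)%E
        & forall w z, h w z <= - kappa w * psi z])
    (D1 : (forall z w, differentiable (h ^~ z) w) /\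
      continuous (fun x : 'rV[R]_p * Z => gradient (h ^~ x.2) x.1))
    (D2 : exists (eta : R) (Psi : Z -> R) (C : 'rV[R]_p -> R),
      [/\ 0 < eta,
          continuous Psi /\ (forall z, 0 <= Psi z),
          locally_bounded C /\ (forall w, 1 <= C w),
          (\int[pi0]_z (Psi z `^ (1 + eta))%:E < +oo)%E
        & forall w z, euclidean_norm (gradient (h ^~ z) w) <= C w * Psi z])
    (K : set 'rV[R]_p) (K_compact : compact K) :
  let H (w : 'rV[R]_p) := maximum (range (h w)) in
  excess (graph_on K (fun w => [set gibbs_mean_gradient pi0 h beta w]))
         (graph_on K (clarke_subdifferential H))
    @[beta --> 0^'+] --> 0%E.
Proof.
move=> H.
have [_ [psi [kappa [_ [_ psi_coercive psi0] [_ kappa1] _ h_le']]]] := H3.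
have [dh gradh_cont] := D1.
have [eta [Psi [C [eta0 [Psi_cont Psi0] [C_bounded _] Psi_int gradh_le]]]] := D2.
have h_le w z : h w z <= - psi z.
  by rewrite (le_trans (h_le' w z))// mulNr lerN2 ler_peMl.
have Psi_integrable : pi0.-integrable setT (EFin \o Psi).
  apply: integrable_of_powR Psi_int => //; last exact: continuous_borel_measurable.
  by rewrite lerDl ltW.
apply: ge0_ecvg0 => [beta|e e0]; first exact: excess_ge0.
have e40 : 0 < e / 4 by rewrite divr_gt0.
pose P beta w' := exists2 x, graph_on K (clarke_subdifferential H) x &
  euclidean_norm (row_mx w' (gibbs_mean_gradient pi0 h beta w') - x) <= e.
have nearP w : K w -> \forall w' \near w & beta \near 0^'+, P beta w'.
  move=> Kw.
  have [[U V] /= [Uw V0] UV] := gibbs_mean_gradient_near H1 H2 psi_coercive psi0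
    h_le gradh_cont Psi_cont Psi0 Psi_integrable C_bounded gradh_le w e40.
  have [B limB] := limiting_gradient_maximum H2 psi_coercive psi0 h_le dh gradh_cont w.
  (* Budget: [e / 2] for the distance of the base points, [e / 4] twice for the distance to the
     hull. *)
  pose r := e / 2 / p.+1%:R; have r0 : 0 < r by rewrite !divr_gt0.
  exists (U `&` ball w r, V) => /=.
    by split => //; apply: filterI => //; exact: nbhsx_ballx.
  move=> [w' beta] /= [[Uw' ww'] Vbeta].
  pose S := limiting_gradient H w `&` [set l | euclidean_norm l <= B].
  have [|d s Ss|c Sc Gc] := @near_convex_hull _ _ S B
    (gibbs_mean_gradient pi0 h beta w') (e / 4) (e / 4) (ltW e40) e40.
  - by move=> l [].
  (* A bound [s] over [S] passes to all gradients at maximizers, since [limB] dominates each of them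
     along [d] by an element of [S]. *)
  - apply: (UV (w', beta)) => //= z hz.
    have [l [Hl lB]] := limB z d hz.
    by move=> /le_trans; apply; apply: Ss.
  exists (row_mx w c).
    exists w, c; split => //.
    exact: (convex_hull_subset (@subIsetl _ _ _)) Sc.
  rewrite opp_row_mx add_row_mx (le_trans (euclidean_norm_row_mx _ _))//.
  have : euclidean_norm (w' - w) <= e / 2.
    rewrite (le_trans (euclidean_norm_le _))//.
    have -> : e / 2 = p.+1%:R * r by rewrite /r [RHS]mulrC divfK.
    apply: ler_pM => //; first by rewrite ler_nat.
    by move: ww'; rewrite -ball_normE/= distrC => /ltW.
  lra.
(* Each point of [K] has its own range of [beta]; compactness yields one range valid on all of
   [K]. *)
have /compact_near_coveringP/(_ _ _ P _ nearP) := K_compact.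
apply: filterS => beta KP; apply: excess_le; first exact: ltW.
by move=> _ [w [_ [Kw -> ->]]]; exact: KP.
Qed.
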